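(* For every positive integer $n$ there exist positive constants $C_n$ and $X_n$ such that for every $x>X_n$, $$d(x)\gg_n e_n\big(C_n(\ln_{n+1}x)^2\big).$$
   Context: A Nov\'ak number is a positive integer $N$ such that $N$ divides $2^N+1$. For $x\ge 1$, $d(x)=\max\{\omega(2^N+1): N\le x,\ N\text{ is a Nov\'ak number}\}$, where $\omega(m)$ is the number of distinct prime factors of $m$. Iterated functions: $e_0(x)=x=\ln_0(x)$, $e_{i+1}(x)=e^{e_i(x)}$, $\ln_{i+1}(x)=\ln(\ln_i(x))$ for $i\ge 0$. *)

(* Defs.v *)
From HB Require Import structures.
From mathcomp Require Export all_boot all_order all_algebra.
From mathcomp Require Export all_reals all_analysis.

Set Implicit Arguments.
Unset Strict Implicit.
Unset Printing Implicit Defensive.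

Import Order.TTheory GRing.Theory Num.Theory.
Local Open Scope ring_scope.

Definition novak (N : nat) : bool := ((0 < N) && (N %| 2 ^ N + 1))%N.

Definition omega (m : nat) : nat := size (primes m).

(* For x >= 1 the index N = 1 satisfies the filter, so this is a maximum over
   a nonempty set; for x < 1 it is 0. *)
Definition novak_d (R : realType) (x : R) : nat :=
  \max_(N < (Num.truncn x).+1 | novak N) omega (2 ^ N + 1)%N.

Definition iter_exp (R : realType) (i : nat) (x : R) : R := iter i expR x.

(* [ln] is 0 on nonpositive arguments, so [iter_ln i x] is the intended
   iterated logarithm only once x is large enough in terms of i. *)
Definition iter_ln (R : realType) (i : nat) (x : R) : R := iter i (@ln R) x.

(* Main.v *)
Require Import Defs.
From mathcomp Require Import all_boot all_order all_algebra.
From mathcomp Require Import all_reals all_analysis.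
From mathcomp Require Import all_classical zify ring lra.
Import Order.TTheory GRing.Theory Num.Theory.

Set Implicit Arguments.
Unset Strict Implicit.
Unset Printing Implicit Defensive.

(* If M is odd and each of its prime factors is at least twice their number, then
   every divisor e >= 16 of M gives 2^e + 1 a primitive prime divisor: otherwise,
   by lifting the exponent, 2^e + 1 would divide the product of q (2^(e/q) + 1)
   over the primes q dividing e, which is only about 2^(e/2). Hence 2^M + 1 has at
   least tau(M) - 16 distinct prime factors.
   If N is a Novak number then so is N P^b, where P is a product of primes dividing
   2^N + 1. Taking for P a product of t large ones among 3t such primes yields a
   Novak number N' <= N (2^N + 1)^b with omega(2^N' + 1) >= (b + 1)^t - 16.
   Starting from N = 3^(3k + 15) with t = k and b = 3^k settles n = 1, since then
   ln ln N' is of order k while omega(2^N' + 1) >= 2^(k^2). With b = 1, a step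
   roughly exponentiates both N and omega(2^N + 1), which turns n into n + 1. *)

(** * Factorization of [y ^ q + 1] and lifting the exponent *)

Lemma exp1D_mod_sqr (u : int) (n : nat) :
  exists w : int, ((1 + u) ^+ n = 1 + n%:Z * u + u ^+ 2 * w)%R.
Proof.
elim: n => [|n [w IH]]; first by exists 0%R; ring.
exists (w + u * w + n%:Z)%R.
by rewrite exprS IH intS; ring.
Qed.

Lemma geom_sum_mod_sqr (u : int) (n : nat) :
  exists w : int, (\sum_(i < n) (1 + u) ^+ i = n%:Z + u * 'C(n, 2)%:Z + u ^+ 2 * w)%R.
Proof.
elim: n => [|n [w IH]]; first by exists 0%R; rewrite big_ord0 bin0n /= !mulr0 !addr0.
have [v Ev] := exp1D_mod_sqr u n.
exists (w + v)%R.
rewrite big_ord_recr /= IH Ev binS bin1 PoszD intS; ring.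
Qed.

Lemma expn_add1_factor (y q : nat) : odd q ->
  y ^ q + 1 = (y + 1) * `|(\sum_(i < q) (- y%:Z) ^+ i)%R : int|%N.
Proof.
move=> oq; rewrite -[y + 1]/(absz (Posz (y + 1))) -abszM -[LHS]/(absz (Posz (y ^ q + 1))).
congr absz; have := subrX1 (- y%:Z)%R q.
rewrite exprNn -signr_odd oq expr1 => /(congr1 (fun x : int => - x)%R) E.
transitivity (- (-1 * y%:Z ^+ q - 1))%R; first by rewrite PoszD -rmorphXn /=; ring.
by rewrite E PoszD; ring.
Qed.

Lemma dvdn_exp2_add1 (a k : nat) : odd k -> 2 ^ a + 1 %| 2 ^ (a * k) + 1.
Proof. by move=> ok; rewrite expnM (expn_add1_factor _ ok) dvdn_mulr. Qed.

(** Here [- y] is 1 modulo [r]. The ['C(q, 2)] term is kept apart because for [r = q] odd it too is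
    a multiple of [r ^ 2]. *)
Lemma expn_add1_cofactor_mod (r q y : nat) : r %| y + 1 ->
  exists k w : int, (\sum_(i < q) (- y%:Z) ^+ i =
    q%:Z + r%:Z * k * 'C(q, 2)%:Z + r%:Z ^+ 2 * w)%R.
Proof.
case/dvdnP=> k Ek; have Ey : (- y%:Z = 1 + r%:Z * - k%:Z)%R by lia.
have [w Ew] := geom_sum_mod_sqr (r%:Z * - k%:Z)%R q.
exists (- k%:Z)%R, (k%:Z ^+ 2 * w)%R; rewrite Ey Ew; ring.
Qed.

(* Lifting the exponent: the cofactor of [y + 1] in [y ^ q + 1] is [q] modulo [r],
   and even modulo [r ^ 2] when [r = q]. *)
Lemma logn_expn_add1 (r q y : nat) : prime r -> prime q -> odd q ->
  r %| y + 1 -> logn r (y ^ q + 1) <= logn r (q * (y + 1)).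
Proof.
move=> pr pq oq ry; have Ef := expn_add1_factor y oq.
have [k [w ES]] := expn_add1_cofactor_mod q ry.
move: Ef ES; set S := (\sum_(i < q) _)%R => Ef ES.
have S0 : 0 < `|S|%N by move: Ef; case: (`|S|%N) => //; lia.
have q0 := prime_gt0 pq.
rewrite Ef mulnC !lognM ?leq_add2r //; try lia.
have [Eq|nqr] := eqVneq q r.
  rewrite -Eq (logn_prime q pq) eqxx leqNgt -pfactor_dvdn //.
  have /dvdnP [c Ec] : q %| 'C(q, 2).
    by apply: prime_dvd_bin => //; have := prime_gt1 pq; case: (q) oq => [|[|[|]]].
  rewrite -Eq Ec PoszM in ES.
  apply/negP => /dvdnP [d Ed].
  have /dvdzP [d' Ed'] : (q%:Z ^+ 2 %| S)%Z by rewrite dvdzE abszX Ed dvdn_mull.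
  have : (q%:Z * (q%:Z * (d' - k * c%:Z - w)) = q%:Z * 1)%R.
    transitivity (S - q%:Z * k * (c%:Z * q%:Z) - q%:Z ^+ 2 * w)%R.
      by rewrite Ed'; ring.
    by rewrite ES; ring.
  move/mulfI; rewrite eqz_nat -lt0n => /(_ q0).
  move/(congr1 absz); rewrite abszM => /eqP; rewrite muln_eq1 => /andP [/eqP q1 _].
  by move: pq; have -> : q = 1 by [].
rewrite (logn_prime r pq) eq_sym (negPf nqr) leqn0 -leqn0 leqNgt -pfactor_dvdn // expn1.
apply/negP => rS.
have : (r%:Z %| S)%Z by rewrite dvdzE.
rewrite ES -addrA rpredDr; last first.
  by rewrite expr2 -!mulrA -mulrDr dvdz_mulr.
by rewrite dvdzE /= dvdn_prime2 // eq_sym (negPf nqr).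
Qed.

Lemma dvdn_mul_expn_add1 (p y : nat) : odd p -> p %| y + 1 ->
  p * (y + 1) %| y ^ p + 1.
Proof.
move=> op py; rewrite (expn_add1_factor y op) mulnC dvdn_pmul2l ?addn1 //.
have [k [w ES]] := expn_add1_cofactor_mod p py.
suff : (p%:Z %| \sum_(i < p) (- y%:Z) ^+ i)%Z%R by rewrite dvdzE.
by rewrite ES expr2 -!mulrA !rpredD ?dvdzz ?dvdz_mulr.
Qed.

(** * Orders and primitive prime divisors *)

Lemma exp2_add1_order (r N : nat) : prime r -> odd N -> r %| 2 ^ N + 1 ->
  exists2 m, m %| N & forall d, odd d -> (r %| 2 ^ d + 1) = (m %| d).
Proof.
move=> pr oN rN.
(* The sign is absorbed as [d] is odd, so [m] is the multiplicative order of [- 2] modulo [r]. *)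
have E d : odd d -> (r %| 2 ^ d + 1) = (((- 2%:R : 'F_r) ^+ d)%R == 1%R).
  move=> od; rewrite (dvdn_pcharf (pchar_Fp pr)) exprNn -signr_odd od expr1 mulN1r.
  by rewrite natrD natrX addr_eq0 eqr_oppLR.
have /eqP EN : (((- 2%:R : 'F_r) ^+ N)%R == 1%R) by rewrite -E.
have [m pm mN] := prim_order_exists (odd_gt0 oN) EN.
by exists m => // d od; rewrite E // (prim_order_dvd pm).
Qed.

(** For odd [e], testing the exponents [e %/ q] is enough: a proper divisor [d] of [e] divides one
    of them, and then [2 ^ d + 1] divides [2 ^ (e %/ q) + 1]. *)
Definition primitive_divisor (r e : nat) : bool :=
  [&& prime r, r %| 2 ^ e + 1 & all (fun q => ~~ (r %| 2 ^ (e %/ q) + 1)) (primes e)].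

(** If [m] were a proper divisor of [e], a prime [q] dividing [e %/ m] would give [m %| e %/ q],
    against primitivity. *)
Lemma primitive_divisor_order (r e m : nat) : odd e -> primitive_divisor r e ->
  (forall d, odd d -> (r %| 2 ^ d + 1) = (m %| d)) -> m = e.
Proof.
move=> oe /and3P [pr re /allP H] Hm; have me : m %| e by rewrite -Hm.
apply/eqP; rewrite eqn_dvd me /= -(divnK me).
suff /eqP -> : e %/ m == 1 by rewrite mul1n.
rewrite eqn_leq divn_gt0 ?(dvdn_leq (odd_gt0 oe)) ?(dvdn_gt0 (odd_gt0 oe)) // andbT.
rewrite leqNgt; apply/negP => lt1.
have qm := pdiv_dvd (e %/ m); have pq := pdiv_prime lt1.
have qe : pdiv (e %/ m) %| e by apply: dvdn_trans qm (dvdn_div me).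
have := H (pdiv (e %/ m)); rewrite mem_primes pq (odd_gt0 oe) qe => /(_ isT).
rewrite Hm; last exact: dvdn_odd (dvdn_div qe) oe.
by rewrite dvdn_divRL // mulnC -dvdn_divRL // qm.
Qed.

Lemma primitive_divisor_inj (r e f : nat) : odd e -> odd f ->
  primitive_divisor r e -> primitive_divisor r f -> e = f.
Proof.
move=> oe of_ he hf; have /and3P [pr re _] := he.
have [m _ Hm] := exp2_add1_order pr oe re.
by rewrite -(primitive_divisor_order oe he Hm) -(primitive_divisor_order of_ hf Hm).
Qed.

(** * Existence of primitive divisors *)

Lemma prime_dvdn_prod (p : nat) (s : seq nat) : prime p -> all prime s ->
  (p %| \prod_(q <- s) q) = (p \in s).
Proof.
move=> pp; elim: s => [|q s IH] /=; first by rewrite big_nil dvdn1 gtn_eqF ?prime_gt1.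
by move=> /andP [pq /IH E]; rewrite big_cons Euclid_dvdM // E dvdn_prime2 // inE.
Qed.

Lemma prod_primes_dvdn (s : seq nat) (e : nat) : uniq s ->
  {subset s <= primes e} -> \prod_(q <- s) q %| e.
Proof.
elim: s => [|p s IH] /=; first by rewrite big_nil dvd1n.
move=> /andP [ps us] sub.
have {}IH : \prod_(q <- s) q %| e by apply: IH us _ => q qs; rewrite sub // inE qs orbT.
have ap : all prime (p :: s).
  by apply/allP => q /sub; rewrite mem_primes => /and3P [].
have /andP [pp as_] := ap.
have : p \in primes e by rewrite sub ?mem_head.
rewrite mem_primes => /and3P [_ _ pe].
by rewrite big_cons Gauss_dvd ?pe // prime_coprime // prime_dvdn_prod.
Qed.

(** Equality holds at [e = 16], the source of the threshold 16 used below. *)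
Lemma leq_exp4_exp2 (e : nat) : 16 <= e -> e ^ 4 <= 2 ^ e.
Proof.
elim: e => // e IH; rewrite leq_eqVlt => /orP [/eqP <- //|h].
have {}IH := IH h; rewrite [2 ^ _]expnS.
apply: leq_trans (leq_mul (leqnn 2) IH).
rewrite !expnS !expn0 !muln1; nia.
Qed.

(* Every [q] contributes at most [e / q <= e / (2 * omega e)] to the exponent,
   so the product is about [2 ^ (e / 2)]. *)
Lemma prod_primes_lt_exp2 (e : nat) : 16 <= e ->
  (forall q, q \in primes e -> 2 * omega e <= q) ->
  \prod_(q <- primes e) (q * (2 ^ (e %/ q) + 1)) < 2 ^ e + 1.
Proof.
move=> e16 H; have e0 : 0 < e by apply: leq_trans e16.
have P1 : \prod_(q <- primes e) (q * (2 ^ (e %/ q) + 1)) <=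
          \prod_(q <- primes e) (q * q * 2 ^ (e %/ q)).
  rewrite big_seq [X in _ <= X]big_seq; apply: leq_prod => q.
  rewrite mem_primes => /and3P [/prime_gt1 q1 _ _].
  have := expn_gt0 2 (e %/ q); nia.
apply: leq_ltn_trans P1 _; rewrite !big_split /= -expn_sum.
have P2 := dvdn_leq e0 (prod_primes_dvdn (primes_uniq e) (fun q h => h)).
have P3 : 2 * \sum_(q <- primes e) e %/ q <= e.
  have [s0|s0] := posnP (omega e).
    by move: s0; rewrite /omega => /eqP; rewrite size_eq0 => /eqP ->; rewrite big_nil.
  rewrite -(leq_pmul2l s0) mulnA [omega e * 2]mulnC big_distrr /=.
  rewrite /omega -sum1_size big_distrl /= -/(omega e).
  rewrite big_seq [X in _ <= X]big_seq; apply: leq_sum => q qe.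
  rewrite mul1n; have := H q qe; have := leq_divM e q.
  rewrite /omega -?sum1_size; nia.
(* Squaring lets [P3] apply without halving [e]: the square is at most [e ^ 4 * 2 ^ e]. *)
rewrite addn1 ltnS -leq_sqr.
apply: (@leq_trans (e ^ 4 * 2 ^ e)).
  rewrite expnMn -expnM; apply: leq_mul; last by rewrite leq_pexp2l // mulnC.
  by rewrite (expnM e 2 2) leq_sqr -mulnn leq_mul.
by rewrite -[(2 ^ e) ^ 2]mulnn leq_mul2r leq_exp4_exp2 ?orbT.
Qed.

Lemma primitive_divisor_exists (e : nat) : odd e -> 16 <= e ->
  (forall q, q \in primes e -> 2 * omega e <= q) ->
  exists r, primitive_divisor r e.
Proof.
move=> oe e16 H.
have [/hasP [r _ hr]|/hasPn N] := boolP (has (primitive_divisor^~ e) (primes (2 ^ e + 1))).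
  by exists r.
have := prod_primes_lt_exp2 e16 H; rewrite ltnNge => /negP [].
set P := \prod_(q <- _) _.
have P0 : 0 < P.
  rewrite /P big_seq; apply: prodn_cond_gt0 => q.
  by rewrite mem_primes muln_gt0 addn_gt0 orbT => /and3P [/prime_gt0 -> ].
apply: dvdn_leq => //.
(* Divisibility is checked one prime power at a time: a non-primitive [r] divides some
   [2 ^ (e %/ q) + 1], and lifting bounds its multiplicity by that in one factor of [P]. *)
apply/dvdn_partP => [|r /= rP]; first by rewrite addn1.
have := N r rP; move: rP; rewrite mem_primes => /and3P [pr _ re].
rewrite /primitive_divisor pr re /= => /allPn [q qe /negPn rq].
move: (qe); rewrite mem_primes => /and3P [pq e0 qde].
rewrite p_part pfactor_dvdn //.
have /(logn_expn_add1 pr pq (dvdn_odd qde oe)) := rq.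
rewrite -expnM divnK // => /leq_trans; apply; apply: dvdn_leq_log => //.
by rewrite /P (big_rem q) //= dvdn_mulr.
Qed.

(** * Counting prime factors through divisors of the exponent *)

Lemma omega_exp2_add1_dvd (M N : nat) : odd N -> M %| N ->
  omega (2 ^ M + 1) <= omega (2 ^ N + 1).
Proof.
move=> oN MN; apply: uniq_leq_size (primes_uniq _) _ => p.
rewrite !mem_primes => /and3P [-> _ pM]; rewrite addn1 /= -addn1.
apply: dvdn_trans pM _; rewrite -(divnK MN) mulnC.
by apply: dvdn_exp2_add1; apply: dvdn_odd (dvdn_div MN) oN.
Qed.

Lemma size_divisors_omega (M : nat) (s : seq nat) : odd M ->
  (forall q, q \in primes M -> 2 * omega M <= q) ->
  uniq s -> (forall e, e \in s -> e %| M) ->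
  size s <= omega (2 ^ M + 1) + 16.
Proof.
move=> oM HM us sM.
have {}sM e : e \in s -> e %| M /\ odd e.
  by move=> /sM eM; split => //; apply: dvdn_odd eM oM.
(* Divisors below 16 number at most 16; the others inject into the primes of [2 ^ M + 1]. *)
rewrite -(count_predC (fun e => 16 <= e) s) -!size_filter; apply: leq_add; last first.
  rewrite -[16](size_iota 0); apply: uniq_leq_size; first exact: filter_uniq.
  by move=> e; rewrite mem_filter mem_iota /= -ltnNge => /andP [].
(* The default 0 is never reached for the divisors [e >= 16] in [s]. *)
pose g e := head 0 [seq r <- primes (2 ^ e + 1) | primitive_divisor r e].
have gP e : e \in [seq e <- s | 16 <= e] -> primitive_divisor (g e) e.
  rewrite mem_filter => /andP [e16 /sM [eM oe]].
  have [|r hr] := primitive_divisor_exists oe e16.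
    have sub : {subset primes e <= primes M}.
      move=> q; rewrite !mem_primes => /and3P [-> _ qe] /=.
      by rewrite odd_gt0 // (dvdn_trans qe).
    move=> q /sub /HM; apply: leq_trans; rewrite leq_mul2l /=.
    exact: uniq_leq_size (primes_uniq _) sub.
  have : r \in [seq r <- primes (2 ^ e + 1) | primitive_divisor r e].
    by rewrite mem_filter hr mem_primes addn1 /= -addn1; case/and3P: hr => -> ->.
  rewrite /g; case E : [seq r <- _ | _] => [//|a l] _ /=.
  have : a \in a :: l by rewrite mem_head.
  by rewrite -E mem_filter => /andP [].
rewrite -(size_map g); apply: uniq_leq_size.
  rewrite map_inj_in_uniq ?filter_uniq // => e f he hf Eg.
  have pe := gP e he; have pf := gP f hf; rewrite -Eg in pf.
  move: he hf; rewrite !mem_filter => /andP [_ /sM [_ oe]] /andP [_ /sM [_ of_]].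
  exact: primitive_divisor_inj pe pf.
move=> _ /mapP [e he ->]; have /and3P [pr re _] := gP e he.
move: he; rewrite mem_filter => /andP [_ /sM [eM oe]].
rewrite mem_primes pr addn1 /= -addn1; apply: dvdn_trans re _.
rewrite -(divnK eM) mulnC; apply: dvdn_exp2_add1.
exact: dvdn_odd (dvdn_div eM) oM.
Qed.

(** * Building new Novak numbers *)

Lemma odd_exp2_add1 (N : nat) : 0 < N -> odd (2 ^ N + 1).
Proof. by move=> N0; rewrite oddD oddX /= orbF addbT -lt0n. Qed.

Lemma novak_odd (N : nat) : novak N -> odd N.
Proof. by move=> /andP [N0 /dvdn_odd]; apply; apply: odd_exp2_add1. Qed.

(** Primes of [m] are moved into [N] one by one; the condition on the rest survives because
    [2 ^ N + 1] divides [2 ^ (N * p) + 1] for odd [p]. *)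
Lemma novak_mul (m N : nat) : 0 < m -> novak N ->
  (forall p, prime p -> p %| m -> p %| 2 ^ N + 1) -> novak (N * m).
Proof.
elim/ltn_ind: m N => m IH N m0 nN H.
have [m1|m1] := leqP m 1; first by rewrite (_ : m = 1) ?muln1 //; lia.
have pp := pdiv_prime m1; have pm := pdiv_dvd m; set p := pdiv m in pp pm.
have /andP [N0 NN] := nN; have pN := H p pp pm.
have op : odd p := dvdn_odd pN (odd_exp2_add1 N0).
rewrite -(divnK pm) [_ * p]mulnC mulnA; apply: IH.
- by rewrite ltn_Pdiv ?prime_gt1.
- by rewrite divn_gt0 ?prime_gt0 // dvdn_leq.
- rewrite /novak muln_gt0 N0 prime_gt0 //= expnM mulnC.
  by apply: dvdn_trans (dvdn_mul_expn_add1 op pN); rewrite dvdn_mul.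
- move=> q pq qm; apply: dvdn_trans (dvdn_exp2_add1 N op); apply: H => //.
  exact: dvdn_trans qm (dvdn_div pm).
Qed.

Lemma divisors_of_prod_primes (s : seq nat) (b : nat) : uniq s -> all prime s ->
  exists l : seq nat, [/\ uniq l, size l = (b + 1) ^ size s &
    forall d, d \in l -> d %| (\prod_(q <- s) q) ^ b].
Proof.
elim: s => [|p s IH] /=; first by exists [:: 1]; split=> // d; rewrite inE => /eqP ->.
move=> /andP [ps us] /andP [pp as_]; have [l [ul sl dl]] := IH us as_.
exists [seq p ^ i * d | i <- iota 0 (b + 1), d <- l]; split.
- apply: allpairs_uniq => //; first exact: iota_uniq.
  (* The valuation at [p] recovers [i] from [p ^ i * d], so the products are distinct. *)
  have cop d : d \in l -> 0 < d /\ logn p d = 0.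
    move=> /dl dd; have P0 : 0 < (\prod_(q <- s) q) ^ b.
      rewrite expn_gt0 big_seq; apply/orP; left; apply: prodn_cond_gt0 => q qs.
      exact/prime_gt0/(allP as_).
    split; first exact: dvdn_gt0 dd.
    apply/eqP; rewrite -leqn0 leqNgt -pfactor_dvdn ?(dvdn_gt0 P0) // expn1.
    apply/negP => pd; have := dvdn_trans pd dd.
    by rewrite Euclid_dvdX // prime_dvdn_prod // (negPf ps).
  move=> _ _ /allpairsP [[i d] /= [_ hd ->]] /allpairsP [[j f] /= [_ hf ->]] /= E.
  have [d0 ld] := cop d hd; have [f0 lf] := cop f hf; have p0 := prime_gt0 pp.
  have := congr1 (logn p) E; rewrite !lognM ?expn_gt0 ?p0 // !pfactorK //.
  rewrite ld lf !addn0 => Eij; move: E; rewrite Eij => /eqP.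
  by rewrite eqn_pmul2l ?expn_gt0 ?p0 // => /eqP ->.
- by rewrite size_allpairs size_iota sl expnS.
- move=> _ /allpairsP [[i d] /= [hi hd ->]].
  rewrite big_cons expnMn dvdn_mul ?dl //; apply: dvdn_exp2l.
  by move: hi; rewrite mem_iota; lia.
Qed.

Lemma omega_exp2_add1_prod_primes (s : seq nat) (b : nat) : uniq s -> all prime s ->
  (forall q, q \in s -> odd q && (2 * size s <= q)) ->
  (b + 1) ^ size s <= omega (2 ^ ((\prod_(q <- s) q) ^ b) + 1) + 16.
Proof.
move=> us ps Hs; have [l [ul <- dl]] := divisors_of_prod_primes b us ps.
apply: size_divisors_omega => //.
  rewrite oddX; apply/orP; right.
  rewrite big_seq; apply: (big_ind odd) => // [x y|q /Hs /andP [] //].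
  by rewrite oddM => -> ->.
have sub : {subset primes ((\prod_(q <- s) q) ^ b) <= s}.
  move=> q; rewrite mem_primes => /and3P [pq _]; rewrite Euclid_dvdX // => /andP [+ _].
  by rewrite prime_dvdn_prod.
move=> q /sub /Hs /andP [_]; apply: leq_trans; rewrite leq_mul2l /=.
exact: uniq_leq_size (primes_uniq _) sub.
Qed.

(* Discarding the fewer than [2 * t] prime divisors of [2 ^ N + 1] below [2 * t]
   leaves [t] primes [q] with [\sum 1 / q <= 1 / 2]. *)
Lemma novak_step (N t b : nat) : novak N -> 3 * t <= omega (2 ^ N + 1) ->
  exists N', [/\ novak N', N' <= N * (2 ^ N + 1) ^ b &
    (b + 1) ^ t <= omega (2 ^ N' + 1) + 16].
Proof.
move=> nN ht; have /andP [N0 _] := nN.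
set Y := 2 ^ N + 1 in ht *; pose big := [seq q <- primes Y | 2 * t <= q].
have tbig : t <= size big.
  have small : count (predC (fun q => 2 * t <= q)) (primes Y) <= 2 * t.
    rewrite -size_filter -[X in _ <= X](size_iota 0); apply: uniq_leq_size.
      exact: filter_uniq (primes_uniq _).
    by move=> q; rewrite mem_filter mem_iota /= -ltnNge => /andP [].
  move: ht; rewrite /omega -(count_predC (fun q => 2 * t <= q)) /big size_filter.
  move=> ht3; rewrite -(leq_add2r (2 * t)); apply: leq_trans (leq_add (leqnn _) small).
  by apply: leq_trans ht3; rewrite addnC -mulSnr.
pose s := take t big; have ss : size s = t by rewrite size_takel.
have us : uniq s by rewrite take_uniq // filter_uniq // primes_uniq.
have sP q : q \in s -> (q \in primes Y) /\ 2 * t <= q.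
  by move=> /mem_take; rewrite mem_filter => /andP [].
have ps : all prime s.
  by apply/allP => q /sP []; rewrite mem_primes => /and3P [].
set P := \prod_(q <- s) q.
have PY : P %| Y by apply: prod_primes_dvdn us _ => q /sP [].
have Y0 : 0 < Y by rewrite /Y addn1.
have P0 := dvdn_gt0 Y0 PY.
have nN' : novak (N * P ^ b).
  apply: novak_mul => //; first by rewrite expn_gt0 P0.
  by move=> p pp; rewrite Euclid_dvdX // => /andP [/dvdn_trans -> //].
exists (N * P ^ b); split => //.
  by rewrite leq_mul2l dvdn_leq ?orbT ?dvdn_exp2r ?expn_gt0 ?Y0.
have := @omega_exp2_add1_prod_primes s b us ps; rewrite ss => /(_ _) H.
apply: leq_trans (H _) _.
  move=> q /sP [+ ->]; rewrite mem_primes andbT => /and3P [_ _ /dvdn_odd]; apply.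
  exact: odd_exp2_add1.
(* The count was made for the exponent [P ^ b], a divisor of the new Novak number. *)
rewrite leq_add2r; apply: omega_exp2_add1_dvd; first exact: novak_odd.
exact: dvdn_mull.
Qed.

(** * The base family, grown from powers of 3 *)

Lemma novak_exp3 (a : nat) : novak (3 ^ a).
Proof.
(* The seed is the Novak number 1, with [2 ^ 1 + 1 = 3]. *)
rewrite -[3 ^ a]mul1n; apply: novak_mul; rewrite ?expn_gt0 //.
by move=> p pp; rewrite Euclid_dvdX // => /andP [].
Qed.

Lemma omega_exp2_add1_exp3 (a : nat) : a + 1 <= omega (2 ^ (3 ^ a) + 1) + 16.
Proof.
have := @omega_exp2_add1_prod_primes [:: 3] a; rewrite big_seq1 /= expn1; apply => //.
by move=> q; rewrite inE => /eqP ->.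
Qed.

Lemma novak_base (k : nat) : 16 <= k ->
  exists N, [/\ novak N, N <= 2 ^ (3 ^ (5 * k)) & 2 ^ (k ^ 2) <= omega (2 ^ N + 1)].
Proof.
(* This gives [a + 1 - 16 = 3 * k], the number of primes that [novak_step] requires for [t = k]. *)
move=> hk; pose a := 3 * k + 15.
have [|N [nN leN om]] := @novak_step (3 ^ a) k (3 ^ k) (novak_exp3 a).
  by have := omega_exp2_add1_exp3 a; rewrite /a; lia.
exists N; split => //.
  apply: leq_trans leN _.
  apply: (@leq_trans (2 ^ (3 ^ a) * (2 ^ (3 ^ a + 1)) ^ (3 ^ k))).
    rewrite leq_mul //; first exact/ltnW/ltn_expl.
    rewrite leq_exp2r ?expn_gt0 // !addn1 expnS; have := expn_gt0 2 (3 ^ a); lia.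
  rewrite -expnM -expnD leq_exp2l //.
  (* [a + k + 1 = 4 * k + 16] is at most [5 * k] because [k >= 16]. *)
  apply: (@leq_trans (3 ^ (a + k + 1))); last by rewrite leq_exp2l // /a; lia.
  rewrite !expnD expn1; have := expn_gt0 3 a; have := expn_gt0 3 k; nia.
rewrite -(leq_add2r 16); apply: leq_trans om.
(* The gap between [2 ^ (k ^ 2)] and [3 ^ (k ^ 2)] absorbs the 16. *)
apply: (@leq_trans (3 ^ (k ^ 2))); last first.
  by rewrite -mulnn expnM leq_exp2r ?addn1 //; lia.
have k2 : 16 <= k ^ 2 by rewrite -mulnn; nia.
elim: (k ^ 2) k2 => // n IH; rewrite leq_eqVlt => /orP [/eqP <- //|h].
by have := IH h; rewrite !expnS; lia.
Qed.

Lemma mul_exp2_add1_leq (N : nat) : N * (2 ^ N + 1) <= 4 ^ N.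
Proof.
rewrite -[4]/(2 ^ 2) -expnM mulnC [2 * N]mulnC expnM -mulnn.
have := ltn_expl N (isT : 1 < 2); move: (2 ^ N) => y; nia.
Qed.

(** * Asymptotics of iterated logarithms and exponentials *)

Local Open Scope classical_set_scope.
Local Open Scope ring_scope.

Lemma cvgry_ln (R : realType) : ln x @[x --> +oo] --> (+oo : set_system R).
Proof.
apply/cvgryPge => A; near=> x.
have xA : expR A <= x by near: x; apply: nbhs_pinfty_ge; rewrite num_real.
by rewrite -[A]expRK ler_ln ?posrE ?expR_gt0 // (lt_le_trans (expR_gt0 A)).
Unshelve. all: by end_near. Qed.

Lemma cvgry_expR (R : realType) : expR x @[x --> +oo] --> (+oo : set_system R).
Proof.
apply/cvgryPge => A; near=> x; apply: (@le_trans _ _ x).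
  by near: x; apply: nbhs_pinfty_ge; rewrite num_real.
by apply: le_trans (expR_ge1Dx x); rewrite lerDr.
Unshelve. all: by end_near. Qed.

Lemma cvgry_iter (R : realType) (f : R -> R) (n : nat) :
  f x @[x --> +oo] --> +oo -> iter n f x @[x --> +oo] --> +oo.
Proof. by move=> cf; elim: n => [|n IH] /=; [exact: cvg_id|exact: cvg_comp IH cf]. Qed.

Lemma near_pinfty_comp (R : realType) (f : R -> R) (P : R -> Prop) :
  f x @[x --> +oo] --> +oo -> (\forall y \near +oo, P y) ->
  \forall x \near +oo, P (f x).
Proof. by move=> cf; apply: cf. Qed.

(** The factor 2 does not accumulate: [w >= z / 2] and [z >= 4] give [w ^ 2 >= z], hence
    [ln w >= ln z / 2]. *)
Lemma iter_ln_half (R : realType) (n : nat) :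
  \forall x \near (+oo : set_system R), iter_ln n x / 2 <= iter_ln n (x / 2).
Proof.
elim: n => [|n IH]; first by near=> x; rewrite /iter_ln /=.
near=> x; rewrite /iter_ln !iterS -!/(iter_ln _ _).
have le_half : iter_ln n x / 2 <= iter_ln n (x / 2) by near: x.
have ge4 : 4 <= iter_ln n x.
  by near: x; move: (4); apply/cvgryPge; apply: cvgry_iter (@cvgry_ln R).
move: (iter_ln n x) (iter_ln n (x / 2)) le_half ge4 => z w zw z4.
rewrite ler_pdivrMr // mulr_natr -lnXn; last by lra.
rewrite ler_ln ?posrE ?exprn_gt0; nra.
Unshelve. all: by end_near. Qed.

Lemma iter_exp_homo (R : realType) (n : nat) :
  {homo @iter_exp R n : x y / x <= y}.
Proof. by move=> x y xy; elim: n => //= n IH; rewrite ler_expR. Qed.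

Lemma iter_exp_half (R : realType) (n : nat) (c : R) : 0 < c ->
  \forall x \near +oo, iter_exp n.+1 x <= c * iter_exp n.+1 (2 * x).
Proof.
(* One half of [b] dominates [a], the other half compensates [ln d]. *)
have expR_half (d a b : R) : 0 < d -> - 2 * ln d <= b -> 2 * a <= b -> expR a <= d * expR b.
  by move=> d0 ab ab'; rewrite -{1}[d](lnK) ?posrE // -expRD ler_expR; lra.
elim: n c => [|n IH] c c0; near=> x; apply: expR_half => //=.
- suff : - ln c <= x by lra.
  by near: x; apply: nbhs_pinfty_ge; rewrite num_real.
- apply: (@le_trans _ _ (iter_exp n.+1 x)).
    near: x; move: (- 2 * ln c); apply/cvgryPge; exact: (@cvgry_iter R expR n.+1 (@cvgry_expR R)).
  apply: iter_exp_homo; suff : 0 <= x by lra.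
  by near: x; apply: nbhs_pinfty_ge; rewrite num_real.
- suff : iter_exp n.+1 x <= 2^-1 * iter_exp n.+1 (2 * x) by rewrite /iter_exp /=; lra.
  by near: x; apply: IH; rewrite invr_gt0.
Unshelve. all: by end_near. Qed.

(** * Numerical exponential bounds and the induction on [n] *)

Lemma expR_half_le_exp2 (R : realType) (n : nat) : expR (n%:R / 2) <= (2 ^ n)%:R :> R.
Proof.
rewrite mulrC expRM_natr natrX lerXn2r ?nnegrE ?expR_ge0 //.
have := expR_ge1Dx (- 2^-1 : R); rewrite expRN => h.
rewrite -[leRHS]invrK -[leLHS]invrK lef_pV2 ?posrE ?invr_gt0 ?expR_gt0 //.
by apply: le_trans h; lra.
Qed.

Lemma exp2_le_expR (R : realType) (n : nat) : (2 ^ n)%:R <= expR n%:R :> R.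
Proof.
rewrite -[n%:R]mulr1 expRM_natl natrX lerXn2r ?nnegrE ?expR_ge0 //.
by have := expR_ge1Dx (1 : R).
Qed.

Lemma exp3_le_expR (R : realType) (n : nat) : (3 ^ n)%:R <= expR (2 * n%:R) :> R.
Proof.
rewrite expRM_natr natrX lerXn2r ?nnegrE ?expR_ge0 //.
by apply: le_trans (expR_ge1Dx (2 : R)); lra.
Qed.

(** A witness [N] replaces the maximum [novak_d], since the next level is built from [N] itself. *)
Definition novak_grows (R : realType) (n : nat) : Prop :=
  exists2 C : R, 0 < C & \forall x \near +oo, exists N : nat,
    [/\ novak N, N%:R <= x &
      iter_exp n (C * iter_ln n.+1 x ^+ 2) <= (omega (2 ^ N + 1))%:R].

Lemma novak_grows1 (R : realType) : novak_grows R 1.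
Proof.
(* With [k >= l / 20], the bound [2 ^ (k ^ 2) >= expR (k ^ 2 / 2)] yields [l ^ 2 / 800]. *)
exists 800^-1; first by rewrite invr_gt0 ltr0n.
near=> x.
have l320 : 320 <= iter_ln 2 x.
  by near: x; move: (320); apply/cvgryPge; apply: (@cvgry_iter R (@ln R) 2 (@cvgry_ln R)).
have x0 : 0 < x by near: x; apply: nbhs_pinfty_gt; rewrite num_real.
have lnx0 : 0 < ln x by near: x; move: (0); apply/cvgryPgt; exact: cvgry_ln.
have Ex : x = expR (expR (iter_ln 2 x)) by rewrite /iter_ln /= !lnK.
set l := iter_ln 2 x in l320 Ex *.
(* [2 ^ (3 ^ (5 * k))] is at most [expR (expR (10 * k))], so [k] is the floor of [l / 10]. *)
have l0 : 0 <= l / 10 by lra.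
have /andP [kl lk] := truncn_itv l0; set k := Num.truncn (l / 10) in kl lk.
have {}lk : l / 10 < k%:R + 1 by rewrite natr1.
have k16 : (16 <= k)%N by rewrite /k truncn_ge_nat //; lra.
have [N [nN leN om]] := novak_base k16.
exists N; split => //.
  rewrite Ex; apply: le_trans (_ : (2 ^ (3 ^ (5 * k)))%:R <= _); first by rewrite ler_nat.
  apply: le_trans (exp2_le_expR _ _) _; rewrite ler_expR.
  by apply: le_trans (exp3_le_expR _ _) _; rewrite ler_expR natrM; lra.
apply: (@le_trans _ _ (2 ^ (k ^ 2))%:R); last by rewrite ler_nat.
apply: le_trans (expR_half_le_exp2 _ _); rewrite /= ler_expR natrX.
have : (l / 20) ^+ 2 <= k%:R ^+ 2 by rewrite lerXn2r ?nnegrE //; lra.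
lra.
Unshelve. all: by end_near. Qed.

Lemma novak_growsS (R : realType) (n : nat) : novak_grows R n.+1 -> novak_grows R n.+2.
Proof.
(* A factor 4 pays for halving the iterated logarithm before squaring; the remaining 2 doubles the
   argument for [iter_exp_half]. *)
move=> [C C0 H]; exists (C / 8); first by rewrite divr_gt0.
have cvg_half : ln x / 2 @[x --> +oo] --> (+oo : set_system R).
  apply/cvgryPge => A; near=> x; suff : 2 * A <= ln x by lra.
  by near: x; move: (2 * A); apply/cvgryPge; exact: cvgry_ln.
have cvg_arg : C / 8 * iter_ln n.+3 x ^+ 2 @[x --> +oo] --> (+oo : set_system R).
  apply/cvgryPge => A; near=> x.
  have h : 1 + 8 / C * `|A| <= iter_ln n.+3 x.
    near: x; move: (1 + _); apply/cvgryPge.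
    exact: (@cvgry_iter R (@ln R) n.+3 (@cvgry_ln R)).
  have A0 : 0 <= 8 / C * `|A| by rewrite mulr_ge0 ?normr_ge0 ?divr_ge0 ?(ltW C0).
  have : 8 / C * `|A| <= iter_ln n.+3 x ^+ 2 by nra.
  have -> : 8 / C * `|A| = (C / 8)^-1 * `|A| by rewrite invf_div.
  rewrite ler_pdivrMl ?divr_gt0 //; apply: le_trans; exact: ler_norm.
have F1 : \forall x \near (+oo : set_system R), 0 < x.
  by apply: nbhs_pinfty_gt; rewrite num_real.
(* From [N <= ln x / 2] the new number is at most [4 ^ N <= expR (2 * N) <= x]. *)
have F2 := near_pinfty_comp cvg_half H.
have F3 := near_pinfty_comp (@cvgry_ln R) (iter_ln_half R n.+2).
have F4 : \forall x \near +oo, 0 <= iter_ln n.+3 x :> R.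
  by move: (0); apply/cvgryPge; exact: (@cvgry_iter R (@ln R) n.+3 (@cvgry_ln R)).
(* Chosen so that [12 * v <= w], whence [w %/ 3 >= 4 * v - 1]. *)
have c12 : 0 < 12^-1 :> R by rewrite invr_gt0.
have F5 := near_pinfty_comp cvg_arg (iter_exp_half n c12).
have F6 : \forall x \near +oo, 20 <= iter_exp n.+1 (C / 8 * iter_ln n.+3 x ^+ 2).
  move: (20); apply/cvgryPge.
  exact: cvg_comp cvg_arg (@cvgry_iter R expR n.+1 (@cvgry_expR R)).
move: F6; apply: filter_app; move: F5; apply: filter_app.
move: F4; apply: filter_app; move: F3; apply: filter_app.
move: F2; apply: filter_app; move: F1; apply: filter_app.
near=> x => x0 [N [nN leN om]] Lhalf L0 v12 v20.
rewrite -[iter_ln n.+2 (ln x)]/(iter n.+2 _ _) -iterSr -/(iter_ln n.+3 x) in Lhalf.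
set w := omega (2 ^ N + 1) in om.
have [|N' [nN' leN' om']] := @novak_step N (w %/ 3) 1 nN.
  by rewrite mulnC leq_divM.
exists N'; split => //.
  apply: (@le_trans _ _ (4 ^ N)%:R).
    rewrite ler_nat; apply: leq_trans leN' _.
    by rewrite expn1 mul_exp2_add1_leq.
  rewrite -[4%N]/(2 ^ 2)%N -expnM; apply: le_trans (exp2_le_expR _ _) _.
  by rewrite -[leRHS]lnK ?posrE // ler_expR natrM; lra.
have vw : iter_exp n.+1 (2 * (C / 8 * iter_ln n.+3 x ^+ 2)) <= w%:R.
  apply: le_trans om; apply: iter_exp_homo.
  have : (iter_ln n.+3 x / 2) ^+ 2 <= iter_ln n.+2 (ln x / 2) ^+ 2.
    by rewrite lerXn2r ?nnegrE //; lra.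
  rewrite -(ler_pM2l C0); lra.
rewrite -[n.+2]/(n.+1.+1) /iter_exp iterS -/(iter_exp n.+1 _).
set v := iter_exp n.+1 (C / 8 * _) in v12 v20 *.
have t6 : 2 * v - 2^-1 <= (w %/ 3)%:R / 2.
  have : w%:R <= ((w %/ 3 + 1) * 3)%:R :> R by rewrite ler_nat addn1 ltnW ?ltn_ceil.
  by rewrite natrM natrD; lra.
have : (2 ^ (w %/ 3))%:R <= (omega (2 ^ N' + 1) + 16)%:R :> R by rewrite ler_nat.
move/(le_trans (expR_half_le_exp2 _ _)).
have /le_trans h : expR (2 * v - 2^-1) <= expR ((w %/ 3)%:R / 2) by rewrite ler_expR.
(* The surplus factor [expR (v - 2^-1)] absorbs the 16, as [v >= 20]. *)
move=> /h; rewrite natrD (_ : 2 * v - 2^-1 = v + (v - 2^-1)); last by ring.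
rewrite expRD.
by have := expR_ge1Dx v; have := expR_ge1Dx (v - 2^-1); nra.
Unshelve. all: by end_near. Qed.

Lemma novak_growsP (R : realType) (n : nat) : novak_grows R n.+1.
Proof. by elim: n => [|n]; [exact: novak_grows1|exact: novak_growsS]. Qed.

Theorem theorem3 (R : realType) (n : nat) (hn : (0 < n)%N) :
  exists C X : R, [/\ 0 < C, 0 < X &
    exists2 c : R, 0 < c & forall x : R, X < x ->
      c * iter_exp n (C * (iter_ln n.+1 x) ^+ 2) <= (novak_d x)%:R].
Proof.
case: n hn => // n _; have [C C0 [X [_ HX]]] := novak_growsP R n.
(* The 1 makes the threshold positive and ensures [x >= 0], where [Num.truncn] is the floor. *)
exists C, (Num.max X 1); split; rewrite ?lt_max ?ltr01 ?orbT //.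
exists 1 => // x; rewrite gt_max mul1r => /andP [/HX [N [nN Nx om]] x1].
apply: le_trans om _; rewrite ler_nat.
have Nt : (N < (Num.truncn x).+1)%N.
  by rewrite ltnS truncn_ge_nat // (le_trans ler01 (ltW x1)).
exact: (@leq_bigmax_cond _ (fun i : 'I__ => novak i)
  (fun i : 'I__ => omega (2 ^ i + 1)) (Ordinal Nt)).
Qed.
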